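(* There exists a complete injective holomorphic immersion $f\colon\mathbb{C}\to\mathbb{C}^2$ whose image $f(\mathbb{C})$ is (everywhere) dense in $\mathbb{C}^2$.
   Context: An immersion $f\colon X\to\mathbb{C}^n=\mathbb{R}^{2n}$ is complete if the image under $f$ of every divergent path in $X$ (a path $[0,1)\to X$ which eventually leaves every compact subset of $X$) has infinite Euclidean length; equivalently, the Riemannian metric $f^*(ds^2)$ on $X$ induced by the Euclidean metric $ds^2$ on $\mathbb{C}^n$ is complete. In the paper ''embedded'' means parametrized by an injective immersion (no properness is required). *)

(* Defs.v *)
From HB Require Import structures.
From mathcomp Require Import all_boot all_order all_algebra.
From mathcomp Require Import complex.
From mathcomp Require Import all_classical all_reals all_analysis.

Set Implicit Arguments.
Unset Strict Implicit.
Unset Printing Implicit Defensive.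

Import Order.TTheory GRing.Theory Num.Theory.
Import numFieldNormedType.Exports.

Local Open Scope classical_set_scope.
Local Open Scope ring_scope.

(* Packing [R[i]] as a [numClosedFieldType] gives it (and ['rV[Cplx R]_n]) the
   canonical topology and normed-module structure, with scalars [Cplx R]. *)
Definition Cplx (R : realType) : numClosedFieldType := R[i].

(* As the scalar field is [Cplx R], [differentiable] is complex
   differentiability and ['d f z] is a complex-linear map. *)
Definition holomorphic (R : realType) (n : nat)
    (f : Cplx R -> 'rV[Cplx R]_n) : Prop :=
  forall z : Cplx R, differentiable f z.

Definition immersion (R : realType) (n : nat)
    (f : Cplx R -> 'rV[Cplx R]_n) : Prop :=
  forall z : Cplx R, injective ('d f z).

(* The library norm on ['rV_n] is the sup norm, so the Euclidean norm of
   C^n = R^(2n) has to be introduced separately. *)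
Definition euclid_norm (R : realType) (n : nat) (v : 'rV[Cplx R]_n) : R :=
  Num.sqrt (\sum_(j < n) (complex.Re (v 0 j) ^+ 2 + complex.Im (v 0 j) ^+ 2)).

(* Same conventions as [variation] and [total_variation] in [realfun]. *)
Definition polygonal_length (R : realType) (n : nat) (a b : R)
    (c : R -> 'rV[Cplx R]_n) (s : seq R) : R :=
  let F := c \o nth b (a :: s) in
  \sum_(0 <= k < size s) euclid_norm (F k.+1 - F k).

Definition arc_length (R : realType) (n : nat) (a b : R)
    (c : R -> 'rV[Cplx R]_n) : \bar R :=
  ereal_sup [set (polygonal_length a b c s)%:E | s in itv_partition a b].

(* Length of a curve parametrized by [0, 1[. *)
Definition euclid_length (R : realType) (n : nat)
    (c : R -> 'rV[Cplx R]_n) : \bar R :=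
  ereal_sup [set arc_length 0 t c | t in `[0, 1[].

(* Only the values of [g] on [0, 1[ matter. *)
Definition divergent_path (R : realType) (X : topologicalType) (g : R -> X) :
    Prop :=
  {within `[0, 1[, continuous g} /\
  forall K : set X, compact K ->
    exists2 t0 : R, t0 \in `[0, 1[ & forall t : R, t0 <= t < 1 -> ~ K (g t).

Definition complete_map (R : realType) (X : topologicalType) (n : nat)
    (f : X -> 'rV[Cplx R]_n) : Prop :=
  forall g : R -> X, divergent_path g -> euclid_length (f \o g) = +oo%E.

(* Main.v *)
Require Import Defs.
From mathcomp Require Import all_boot all_order all_algebra.
From mathcomp Require Import complex.
From mathcomp Require Import all_classical all_reals all_analysis.
From mathcomp Require Import ring lra.
Import Order.TTheory GRing.Theory Num.Theory.
Import numFieldNormedType.Exports.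
Local Open Scope classical_set_scope.
Local Open Scope ring_scope.

Set Implicit Arguments.
Unset Strict Implicit.
Unset Printing Implicit Defensive.

(** The line is a limit of polynomially embedded lines f_n (z) = T_n (z, 0),
where T_n is a composition of polynomial shears of C^2, taken along discs
|z| <= r_n with r_n tending to infinity.

Density.  To pass from T to the next automorphism, let q be the point to be
reached and let (a, b) be its preimage under T.  If b = 0 then q already lies
on the curve.  If b <> 0, choose w outside the disc |z| <= r and precompose T
with the two shears
  y' = y + b (x / w)^n   and   x' = x + ((a - w) / b) y'.
They send (w, 0) to (a, b), so the new curve goes through q; and on the axis
over |x| <= r they tend to the identity as n grows, because |x / w| < 1.  Since
w is any point outside the disc, nothing has to be known about the position of
q relative to the part of the curve that is already fixed
([curve_through_point]).

Completeness costs nothing.  Each f_n is proper, as z is recovered from f_n (z)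
by a polynomial map; so r_n may be chosen with |f_n| >= n on the circle
|z| = r_n, and later corrections are too small on the disc to spoil this.  The
limit F is thus large on a sequence of circles going to infinity, though it is
far from proper.  A divergent path meets all but finitely many of those
circles, so its image is unbounded and has infinite length
([complete_of_circles]).

Injectivity and immersivity of the limit.  As T_n^-1 is Lipschitz on bounded
sets, |f_n (z) - f_n (w)| >= c_n |z - w| on the disc |z| <= r_n.  If the sum of
the later corrections has there a Lipschitz constant below c_n, then F satisfies
an inequality of the same kind, which gives at once that F is injective and that
F' does not vanish ([dense_line_data], [derivative_neq0]).

Corrections are measured by the coefficient norm sum_k |p_k| r^k instead of the
supremum over a disc.  It is submultiplicative, hence polynomial maps are
Lipschitz for it on bounded sets, and it dominates on a slightly smaller disc
the values, the Lipschitz constant and the second order Taylor remainder of p.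
This makes the limit holomorphic by direct estimates, without Cauchy's integral
formula. *)

(** * Modulus of a complex number as an element of R *)

Section Modulus.
Variable R : realType.
Implicit Types z w : Cplx R.

(** The norm of [Cplx R] takes its values in [Cplx R]; a modulus with values in
[R] gives access to the total order and to suprema. *)
Definition cabs z : R := complex.Re `|z|.

Lemma cabsE z : `|z| = (cabs z)%:C%C.
Proof. by rewrite /cabs normc_def. Qed.

Lemma cabs_def z :
  cabs z = Num.sqrt (complex.Re z ^+ 2 + complex.Im z ^+ 2).
Proof. by rewrite /cabs normc_def. Qed.

Lemma cabs_ge0 z : 0 <= cabs z.
Proof. by rewrite -(lecR _ (cabs z)) -cabsE normr_ge0. Qed.

Lemma cabsM z w : cabs (z * w) = cabs z * cabs w.
Proof. by apply: (@complexI R); rewrite rmorphM /= -!cabsE normrM. Qed.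

Lemma cabsD z w : cabs (z + w) <= cabs z + cabs w.
Proof. by rewrite -lecR rmorphD /= -!cabsE ler_normD. Qed.

Lemma cabsN z : cabs (- z) = cabs z.
Proof. by rewrite /cabs normrN. Qed.

Lemma cabsBC z w : cabs (z - w) = cabs (w - z).
Proof. by rewrite -cabsN opprB. Qed.

Lemma cabsB z w : cabs z <= cabs w + cabs (z - w).
Proof. by apply: le_trans (cabsD _ _); rewrite addrC subrK. Qed.

Lemma cabs0 : cabs 0 = 0.
Proof. by rewrite /cabs normr0. Qed.

Lemma cabs1 : cabs 1 = 1.
Proof. by rewrite /cabs normr1. Qed.

Lemma cabs_eq0 z : (cabs z == 0) = (z == 0).
Proof. by rewrite -(inj_eq (@complexI R)) -cabsE normr_eq0. Qed.

Lemma cabs_gt0 z : (0 < cabs z) = (z != 0).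
Proof. by rewrite lt_def cabs_eq0 cabs_ge0 andbT. Qed.

Lemma cabsV z : cabs z^-1 = (cabs z)^-1.
Proof.
have [->|z0] := eqVneq z 0; first by rewrite invr0 cabs0 invr0.
apply: (@mulfI _ (cabs z)); first by rewrite cabs_eq0.
by rewrite -cabsM !divff ?cabs_eq0 ?cabs1.
Qed.

Lemma cabs_real (x : R) : cabs x%:C%C = `|x|.
Proof. by rewrite cabs_def /= expr0n /= addr0 sqrtr_sqr. Qed.

Lemma cabs_Re z : `|complex.Re z| <= cabs z.
Proof. by rewrite -sqrtr_sqr cabs_def ler_wsqrtr // lerDl sqr_ge0. Qed.

Lemma cabs_Im z : `|complex.Im z| <= cabs z.
Proof. by rewrite -sqrtr_sqr cabs_def ler_wsqrtr // lerDr sqr_ge0. Qed.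

Lemma cabs_ReIm z : cabs z <= `|complex.Re z| + `|complex.Im z|.
Proof.
case: z => x y; rewrite cabs_def /=.
rewrite -(ger0_norm (addr_ge0 (normr_ge0 x) (normr_ge0 y))).
rewrite -sqrtr_sqr ler_wsqrtr // sqrrD !real_normK ?num_real //.
by rewrite -addrA lerD2l lerDr mulrn_wge0 ?mulr_ge0.
Qed.

End Modulus.

(** * The coefficient norm of a polynomial *)

Section Coefficient_norm.
Variable R : realType.
Implicit Types (p q : {poly Cplx R}) (r : R) (z w h : Cplx R).

Definition cnorm r p : R := \sum_(k < size p) cabs p`_k * r ^+ k.

Lemma cnorm_widen r p n : (size p <= n)%N ->
  cnorm r p = \sum_(k < n) cabs p`_k * r ^+ k.
Proof.
move=> le_pn; rewrite /cnorm (big_ord_widen n (fun k => cabs p`_k * r ^+ k)) //.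
rewrite big_mkcond; apply: eq_bigr => k _; case: ltnP => // lt_pk.
by rewrite nth_default // cabs0 mul0r.
Qed.

Lemma cnorm_ge0 r p : 0 <= r -> 0 <= cnorm r p.
Proof.
by move=> r0; apply: sumr_ge0 => k _; rewrite mulr_ge0 ?cabs_ge0 ?exprn_ge0.
Qed.

Lemma cnorm_le r s p : 0 <= r -> r <= s -> cnorm r p <= cnorm s p.
Proof.
move=> r0 rs; apply: ler_sum => k _; rewrite ler_wpM2l ?cabs_ge0 //.
by rewrite lerXn2r // nnegrE // (le_trans r0).
Qed.

Lemma cnormD r p q : 0 <= r -> cnorm r (p + q) <= cnorm r p + cnorm r q.
Proof.
move=> r0; pose n := maxn (size p) (size q).
rewrite (@cnorm_widen r p n) ?leq_maxl // (@cnorm_widen r q n) ?leq_maxr //.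
rewrite (@cnorm_widen r _ n) ?size_polyD // -big_split /=.
apply: ler_sum => k _; rewrite -mulrDl ler_wpM2r ?exprn_ge0 //.
by rewrite coefD cabsD.
Qed.

Lemma cnormZ r c p : cnorm r (c *: p) = cabs c * cnorm r p.
Proof.
rewrite (@cnorm_widen r _ (size p)) ?size_scale_leq // mulr_sumr.
by apply: eq_bigr => k _; rewrite coefZ cabsM mulrA.
Qed.

Lemma cnormN r p : cnorm r (- p) = cnorm r p.
Proof. by rewrite -scaleN1r cnormZ cabsN cabs1 mul1r. Qed.

(** The Horner step, through which the estimates below are all proved by
induction on [p]. *)
Lemma cnormMXaddC r p c : cnorm r (p * 'X + c%:P) = cnorm r p * r + cabs c.
Proof.
rewrite (@cnorm_widen r _ (size p).+1); last first.
  by rewrite (leq_trans (size_polyD _ _)) // geq_max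
    (leq_trans (size_polyMleq _ _)) ?size_polyX ?addn2 //
    (leq_trans (size_polyC_leq1 _)).
rewrite big_ord_recl addrC; congr (_ + _).
  rewrite mulr_suml; apply: eq_bigr => k _.
  by rewrite coefD coefMX coefC /= addr0 exprSr mulrA.
by rewrite coefD coefMX coefC /= add0r mulr1.
Qed.

Lemma cnorm0 r : cnorm r 0 = 0.
Proof. by rewrite /cnorm size_poly0 big_ord0. Qed.

Lemma cnormC r c : cnorm r c%:P = cabs c.
Proof. by rewrite -[c%:P]add0r -(mul0r 'X) cnormMXaddC cnorm0 mul0r add0r. Qed.

Lemma cnormX r : cnorm r 'X = r.
Proof.
by rewrite -['X]addr0 -['X in LHS]mul1r (cnormMXaddC r 1 0) cnormC cabs1 cabs0
  addr0 mul1r.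
Qed.

Lemma cnormM r p q : 0 <= r -> cnorm r (p * q) <= cnorm r p * cnorm r q.
Proof.
move=> r0; elim/poly_ind: p => [|p c IH]; first by rewrite mul0r cnorm0 mul0r.
rewrite mulrDl mulrAC mul_polyC cnormMXaddC mulrDl.
apply: le_trans (cnormD _ _ r0) _; rewrite cnormZ lerD2r.
rewrite -[_ * 'X]addr0 (cnormMXaddC r (p * q) 0) cabs0 addr0 mulrAC.
by rewrite ler_wpM2r.
Qed.

Lemma cnormXn r p n : 0 <= r -> cnorm r (p ^+ n) <= cnorm r p ^+ n.
Proof.
move=> r0; elim: n => [|n IH]; first by rewrite !expr0 cnormC cabs1.
rewrite !exprS; apply: le_trans (cnormM _ _ r0) _.
by rewrite ler_wpM2l ?cnorm_ge0.
Qed.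

Lemma cabs_horner r p z : cabs z <= r -> cabs p.[z] <= cnorm r p.
Proof.
move=> zr; have r0 := le_trans (cabs_ge0 z) zr.
elim/poly_ind: p => [|p c IH]; first by rewrite horner0 cabs0 cnorm0.
rewrite cnormMXaddC !(hornerD, hornerM, hornerX, hornerC).
apply: le_trans (cabsD _ _) _.
by rewrite lerD2r cabsM ler_pM ?cabs_ge0.
Qed.

(** Widening the radius by 1 absorbs the factor [k] in
[|z^k - w^k| <= k r^(k-1) |z - w|], since [k r^(k-1) <= (r+1)^k]. *)
Lemma cabs_horner_lip r p z w : cabs z <= r -> cabs w <= r ->
  cabs (p.[z] - p.[w]) <= cnorm (r + 1) p * cabs (z - w).
Proof.
move=> zr wr; have r0 := le_trans (cabs_ge0 z) zr.
elim/poly_ind: p => [|p c IH]; first by rewrite !horner0 subrr cabs0 cnorm0 mul0r.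
rewrite cnormMXaddC !(hornerD, hornerM, hornerX, hornerC).
have -> : p.[z] * z + c - (p.[w] * w + c) = (p.[z] - p.[w]) * z + p.[w] * (z - w).
  by ring.
apply: le_trans (cabsD _ _) _; rewrite !cabsM.
have pw : cabs p.[w] <= cnorm (r + 1) p.
  by apply: le_trans (cabs_horner p wr) (cnorm_le _ _ _); lra.
have := cabs_ge0 (z - w); have := cabs_ge0 z; have := cabs_ge0 c.
have := cabs_ge0 (p.[z] - p.[w]); have := cabs_ge0 p.[w].
move: IH pw zr; set a := cabs (_ - _); set b := cabs p.[w]; set d := cabs (z - w).
set e := cabs z; set N := cnorm _ _; set cc := cabs c => IH pw zr b0 a0 c0 e0 d0.
have h1 : a * e <= N * d * r by apply: ler_pM.
have h2 : b * d <= N * d by apply: ler_wpM2r.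
by have h3 : 0 <= cc * d; [apply: mulr_ge0|nra].
Qed.

Lemma cabs_deriv r p z : cabs z <= r -> cabs p^`().[z] <= cnorm (r + 1) p.
Proof.
move=> zr; have r0 := le_trans (cabs_ge0 z) zr.
elim/poly_ind: p => [|p c IH]; first by rewrite deriv0 horner0 cabs0 cnorm0.
rewrite cnormMXaddC derivD derivC derivM derivX mulr1 addr0.
rewrite !(hornerD, hornerM, hornerX, hornerC).
apply: le_trans (cabsD _ _) _; rewrite cabsM.
have pw : cabs p.[z] <= cnorm (r + 1) p.
  by apply: le_trans (cabs_horner p zr) (cnorm_le _ _ _); lra.
have h1 : cabs p^`().[z] * cabs z <= cnorm (r + 1) p * r.
  by apply: ler_pM; rewrite ?cabs_ge0.
by have := cabs_ge0 c; lra.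
Qed.

(** Widening the radius by 2: once for the point [z + h], and once more for the
Lipschitz estimate at that radius. *)
Lemma cabs_taylor r p z h : cabs z <= r -> cabs h <= 1 ->
  cabs (p.[z + h] - p.[z] - h * p^`().[z]) <= cnorm (r + 2) p * cabs h ^+ 2.
Proof.
move=> zr h1; have r0 := le_trans (cabs_ge0 z) zr.
elim/poly_ind: p => [|p c IH].
  by rewrite deriv0 !horner0 mulr0 !subr0 cabs0 cnorm0 mul0r.
rewrite cnormMXaddC derivD derivC derivM derivX mulr1 addr0.
rewrite !(hornerD, hornerM, hornerX, hornerC).
set d := p^`().[z] in IH *.
have -> : p.[z + h] * (z + h) + c - (p.[z] * z + c) - h * (d * z + p.[z])
  = (p.[z + h] - p.[z] - h * d) * z + (p.[z + h] - p.[z]) * h by ring.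
apply: le_trans (cabsD _ _) _; rewrite !cabsM.
have zhr : cabs (z + h) <= r + 1 by apply: le_trans (cabsD _ _) _; lra.
have zr1 : cabs z <= r + 1 by lra.
have L : cabs (p.[z + h] - p.[z]) <= cnorm (r + 2) p * cabs h.
  have := cabs_horner_lip p zhr zr1.
  by rewrite [z + h - z]addrAC subrr add0r -(addrA r 1 1).
have e1 : cabs (p.[z + h] - p.[z] - h * d) * cabs z
    <= cnorm (r + 2) p * cabs h ^+ 2 * r by apply: ler_pM; rewrite ?cabs_ge0.
have e2 : cabs (p.[z + h] - p.[z]) * cabs h <= cnorm (r + 2) p * cabs h * cabs h.
  by apply: ler_pM; rewrite ?cabs_ge0.
have N0 : 0 <= cnorm (r + 2) p by apply: cnorm_ge0; lra.
have e3 : 0 <= cabs c * cabs h ^+ 2 by rewrite mulr_ge0 ?cabs_ge0 ?exprn_ge0 ?cabs_ge0.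
have e4 : 0 <= cnorm (r + 2) p * cabs h ^+ 2 by rewrite mulr_ge0 ?exprn_ge0 ?cabs_ge0.
by nra.
Qed.

End Coefficient_norm.
(** * Polynomial automorphisms of the plane *)

Section Polynomial_automorphisms.
Variable R : realType.
Local Notation C := (Cplx R).
Local Notation P := {poly Cplx R}.
Implicit Types (p q g : P) (u v : P * P) (a b : C * C) (r : R) (z w : C).
Implicit Types (T S : P * P -> P * P) (t s : C * C -> C * C).

Definition cabs2 a : R := cabs a.1 + cabs a.2.
Definition cnorm2 r u : R := cnorm r u.1 + cnorm r u.2.
Definition eval2 u z : C * C := (u.1.[z], u.2.[z]).

Lemma cabs2_ge0 a : 0 <= cabs2 a.
Proof. by rewrite addr_ge0 ?cabs_ge0. Qed.

Lemma cabs2D a b : cabs2 (a + b) <= cabs2 a + cabs2 b.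
Proof.
by rewrite /cabs2 /= addrACA lerD ?cabsD.
Qed.

Lemma cabs2BC a b : cabs2 (a - b) = cabs2 (b - a).
Proof. by rewrite /cabs2 /= cabsBC [cabs (a.2 - _)]cabsBC. Qed.

Lemma cabs2B a b : cabs2 a <= cabs2 b + cabs2 (a - b).
Proof. by apply: le_trans (cabs2D _ _); rewrite addrC subrK. Qed.

Lemma cnorm2_ge0 r u : 0 <= r -> 0 <= cnorm2 r u.
Proof. by move=> r0; rewrite addr_ge0 ?cnorm_ge0. Qed.

Lemma cnorm2D r u v : 0 <= r -> cnorm2 r (u + v) <= cnorm2 r u + cnorm2 r v.
Proof. by move=> r0; rewrite /cnorm2 /= addrACA lerD ?cnormD. Qed.

Lemma cnorm2B r u v : 0 <= r -> cnorm2 r u <= cnorm2 r v + cnorm2 r (u - v).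
Proof. by move=> r0; apply: le_trans (cnorm2D _ _ r0); rewrite addrC subrK. Qed.

Lemma eval2B u v z : eval2 (u - v) z = eval2 u z - eval2 v z.
Proof. by rewrite /eval2 !hornerD !hornerN. Qed.

Lemma cabs2_eval r u z : cabs z <= r -> cabs2 (eval2 u z) <= cnorm2 r u.
Proof. by move=> zr; rewrite lerD ?cabs_horner. Qed.

(** [t] is a map of the plane and [T] its lift, acting by the same formulas on
pairs of polynomials.  The lift turns a parametrized curve into its image curve,
and its Lipschitz property transfers smallness from perturbations of a curve to
perturbations of the image.  Everything used about polynomial maps is contained
in these two clauses, which are moreover stable under composition. *)
Definition tame T t : Prop :=
  (forall u z, eval2 (T u) z = t (eval2 u z)) /\
  (forall r B, 0 <= r -> exists2 L, 0 <= L &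
     forall u v, cnorm2 r u <= B -> cnorm2 r v <= B ->
       cnorm2 r (T u - T v) <= L * cnorm2 r (u - v)).

Lemma tame_comp T t S s : tame T t -> tame S s -> tame (T \o S) (t \o s).
Proof.
move=> [evT lipT] [evS lipS]; split=> [u z|r B r0] /=; first by rewrite evT evS.
have [L L0 LS] := lipS r (Num.max B 0) r0.
have [M M0 MT] := lipT r (cnorm2 r (S 0) + L * Num.max B 0) r0.
have cn0 : cnorm2 r 0 = 0 by rewrite /cnorm2 /= cnorm0 addr0.
have bd u : cnorm2 r u <= B ->
    cnorm2 r (S u) <= cnorm2 r (S 0) + L * Num.max B 0.
  move=> uB; apply: le_trans (cnorm2B (S u) (S 0) r0) _; rewrite lerD2l.
  apply: le_trans (LS _ _ _ _) _; rewrite ?cn0 ?le_max ?uB ?lexx ?orbT //.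
  by rewrite subr0 ler_wpM2l // le_max uB.
exists (M * L); first exact: mulr_ge0.
move=> u v uB vB; apply: le_trans (MT _ _ (bd u uB) (bd v vB)) _.
by rewrite -mulrA ler_wpM2l // LS // le_max ?uB ?vB.
Qed.

(** A point is a constant curve, whose coefficient norm is the modulus for every
radius; so the Lipschitz property of the lift passes to points. *)
Lemma tame_lip_points T t B : tame T t ->
  exists2 L, 0 <= L & forall a b, cabs2 a <= B -> cabs2 b <= B ->
    cabs2 (t a - t b) <= L * cabs2 (a - b).
Proof.
move=> [evT lipT]; have [L L0 LT] := lipT 0 B (lexx 0); exists L => // a b aB bB.
pose k a : P * P := (a.1%:P, a.2%:P).
have ek c : eval2 (k c) 0 = c by case: c => c1 c2; rewrite /eval2 /k !hornerC.
have nk c : cnorm2 0 (k c) = cabs2 c by rewrite /cnorm2 /= !cnormC.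
have kB : k (a - b) = k a - k b by rewrite /k /= !polyCB.
rewrite -[t a - t b](_ : eval2 (T (k a) - T (k b)) 0 = _); last first.
  by rewrite eval2B !evT !ek.
apply: le_trans (cabs2_eval (r := 0) _ _) _; first by rewrite cabs0.
by rewrite -(nk (a - b)) kB; apply: LT; rewrite nk.
Qed.

(** Horner induction on [g]: in the step,
[g(p) p - g(q) q = (g(p) - g(q)) p + g(q) (p - q)], and [g(q)] is bounded because
it is at a bounded distance from [g(0)]. *)
Lemma cnorm_comp_lip g r B : 0 <= r -> exists2 L, 0 <= L &
  forall p q, cnorm r p <= B -> cnorm r q <= B ->
    cnorm r ((g \Po p) - (g \Po q)) <= L * cnorm r (p - q).
Proof.
move=> r0; wlog B0 : B / 0 <= B => [H|].
  have [|L L0 HL] := H (Num.max B 0); first by rewrite le_max lexx orbT.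
  by exists L => // p q pB qB; apply: HL; rewrite le_max ?pB ?qB.
elim/poly_ind: g => [|g c [L L0 IH]].
  by exists 0 => // p q _ _; rewrite !comp_poly0 subrr cnorm0 mul0r.
have cn0 : cnorm r 0 <= B by rewrite cnorm0.
pose D := cnorm r (g \Po 0) + L * B.
exists (L * B + D) => [|p q pB qB].
  by rewrite !addr_ge0 ?mulr_ge0 ?cnorm_ge0.
rewrite !comp_polyD !comp_polyM !comp_polyX !comp_polyC.
have -> : (g \Po p) * p + c%:P - ((g \Po q) * q + c%:P) =
  ((g \Po p) - (g \Po q)) * p + (g \Po q) * (p - q) by ring.
apply: le_trans (cnormD _ _ r0) _; rewrite [leRHS]mulrDl lerD //.
  apply: le_trans (cnormM _ _ r0) _; rewrite mulrAC.
  by rewrite ler_pM ?cnorm_ge0 // IH.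
apply: le_trans (cnormM _ _ r0) _; rewrite ler_wpM2r ?cnorm_ge0 //.
have -> : g \Po q = (g \Po 0) + ((g \Po q) - (g \Po 0)) by rewrite addrC subrK.
apply: le_trans (cnormD _ _ r0) _; rewrite lerD2l.
by apply: le_trans (IH _ _ qB cn0) _; rewrite subr0 ler_wpM2l.
Qed.

Definition shear g u : P * P := (u.1, u.2 + (g \Po u.1)).
Definition shear_pt g a : C * C := (a.1, a.2 + g.[a.1]).

Lemma tame_shear g : tame (shear g) (shear_pt g).
Proof.
split=> [u z|r B r0]; first by rewrite /eval2 /= hornerD horner_comp.
have [L L0 HL] := cnorm_comp_lip g B r0; exists (1 + L) => [|u v uB vB].
  by rewrite addr_ge0.
have uB1 : cnorm r u.1 <= B by apply: le_trans uB; rewrite lerDl cnorm_ge0.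
have vB1 : cnorm r v.1 <= B by apply: le_trans vB; rewrite lerDl cnorm_ge0.
rewrite {1}/cnorm2 /= opprD addrACA.
have := cnormD (u.2 - v.2) ((g \Po u.1) - (g \Po v.1)) r0; have := HL _ _ uB1 vB1.
have : 0 <= L * cnorm r (u.2 - v.2) by rewrite mulr_ge0 ?cnorm_ge0.
by rewrite /cnorm2 /=; lra.
Qed.

Definition swap (V : Type) (x : V * V) : V * V := (x.2, x.1).

Lemma tame_swap : tame (@swap P) (@swap C).
Proof.
split=> [u z //|r B r0]; exists 1 => // u v _ _.
by rewrite mul1r /cnorm2 /= addrC.
Qed.

Definition tame_aut T t : Prop :=
  exists S s, [/\ tame T t, tame S s, cancel t s & cancel s t].

Lemma tame_aut_id : tame_aut id id.
Proof.
have tid : tame id id.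
  by split=> // r B r0; exists 1 => // u v _ _; rewrite mul1r.
by exists id, id; split.
Qed.

Lemma tame_aut_comp T t S s : tame_aut T t -> tame_aut S s ->
  tame_aut (T \o S) (t \o s).
Proof.
move=> [T' [t' [tT tT' tK t'K]]] [S' [s' [tS tS' sK s'K]]].
exists (S' \o T'), (s' \o t'); split; try exact: tame_comp; exact: can_comp.
Qed.

Lemma tame_aut_shear g : tame_aut (shear g) (shear_pt g).
Proof.
exists (shear (- g)), (shear_pt (- g)); split; try exact: tame_shear.
  by move=> [x y]; rewrite /shear_pt /= hornerN addrK.
by move=> [x y]; rewrite /shear_pt /= hornerN subrK.
Qed.

Lemma tame_aut_swap : tame_aut (@swap P) (@swap C).
Proof.
exists (@swap P), (@swap C); split; try exact: tame_swap; by case.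
Qed.

(** The line [z |-> (z, 0)] in the plane. *)
Definition axis : P * P := ('X, 0).

Lemma eval2_axis z : eval2 axis z = (z, 0).
Proof. by rewrite /eval2 hornerX horner0. Qed.

(** The parameter [z] is the first coordinate of [s (t (z, 0))], and the inverse
[s] is Lipschitz on bounded sets. *)
Lemma curve_embedding T t r : tame_aut T t -> 0 <= r ->
  exists2 c, 0 < c & forall z w, cabs z <= r -> cabs w <= r ->
    c * cabs (z - w) <= cabs2 (eval2 (T axis) z - eval2 (T axis) w).
Proof.
move=> [S [s [[evT _] tS tK sK]]] r0.
have [L L0 HL] := tame_lip_points (cnorm2 r (T axis)) tS.
have L1 : 0 < L + 1 by lra.
exists (L + 1)^-1 => [|z w zr wr]; first by rewrite invr_gt0.
rewrite mulrC ler_pdivrMr //.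
have := HL _ _ (cabs2_eval (T axis) zr) (cabs2_eval (T axis) wr).
rewrite !evT !tK !eval2_axis {1}/cabs2 /= subrr cabs0 addr0.
have := cabs2_ge0 (t (z, 0) - t (w, 0)); lra.
Qed.

(** Again because [z] is read off from the point of the curve by the inverse
automorphism, which is bounded on bounded sets. *)
Lemma curve_proper T t M : tame_aut T t ->
  exists rho, forall z, cabs2 (eval2 (T axis) z) <= M -> cabs z <= rho.
Proof.
move=> [S [s [[evT _] tS tK sK]]].
have [L L0 HL] := tame_lip_points (Num.max M 0) tS.
exists (cabs2 (s 0) + L * M) => z zM.
have c0 : cabs2 (0 : C * C) = 0 by rewrite /cabs2 /= cabs0 addr0.
have b0 : cabs2 (0 : C * C) <= Num.max M 0 by rewrite c0 le_max lexx orbT.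
have b1 : cabs2 (eval2 (T axis) z) <= Num.max M 0 by rewrite le_max zM.
have -> : cabs z = cabs2 (s (eval2 (T axis) z)).
  by rewrite evT tK eval2_axis /cabs2 /= cabs0 addr0.
apply: le_trans (cabs2B _ (s 0)) _; rewrite lerD2l.
by apply: le_trans (HL _ _ b1 b0) _; rewrite subr0 ler_wpM2l.
Qed.

Lemma exists_expr_le (rho K e : R) : 0 <= rho -> rho < 1 -> 0 < e ->
  exists n, K * rho ^+ n <= e.
Proof.
move=> rho0 rho1 e0.
have /cvgrPdist_le : (fun n => K * rho ^+ n) @ \oo --> K * 0.
  by apply: cvgMr; apply: cvg_expr; rewrite ger0_norm.
move=> /(_ e e0)[n _ /(_ n (leqnn n))] /=; rewrite mulr0 sub0r normrN => h.
by exists n; apply: le_trans h; apply: ler_norm.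
Qed.

(** The density step: the image of the axis can be made to pass through any
prescribed point by an arbitrarily small change over a given disc.  Precomposing
with [F] keeps the curve an image of the axis under an automorphism, and the
size of the change is controlled by the Lipschitz constant of [T]. *)
Lemma curve_through_point T t (q : C * C) r e :
  tame_aut T t -> 0 <= r -> 0 < e ->
  exists T' t' z, [/\ tame_aut T' t',
    cnorm2 r (T' axis - T axis) <= e & eval2 (T' axis) z = q].
Proof.
move=> aT r0 e0; have [S [s [[evT lipT] _ _ sK]]] := aT.
case E : (s q) => [a b]; have tq : t (a, b) = q by rewrite -E sK.
have [b0|b0] := eqVneq b 0.
  exists T, t, a; split=> //; last by rewrite evT eval2_axis -b0.
  by rewrite subrr /cnorm2 /= cnorm0 addr0 ltW.
(* The parameter that is sent to q; any point outside the disc would do. *)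
pose w : C := (r + 1)%:C%C.
have w0 : w != 0 by rewrite -cabs_gt0 cabs_real ger0_norm; lra.
(* [al] is the slope of the second shear: once the first shear has lifted
   (w, 0) to (w, b), the second one moves it to (w + al b, b) = (a, b). *)
pose al := (a - w) / b.
have [L L0 HL] := lipT r (cnorm2 r axis + 1) r0.
pose K := (cabs al + 1) * cabs b.
have rho0 : 0 <= r / (r + 1) by rewrite divr_ge0; lra.
have rho1 : r / (r + 1) < 1 by rewrite ltr_pdivrMr; lra.
(* The bound 1 keeps [F axis] in the ball on which [L] is valid. *)
have L1 : 0 < L + 1 by lra.
have e'0 : 0 < Num.min 1 (e / (L + 1)) by rewrite lt_min ltr01 divr_gt0.
have [n Hn] := exists_expr_le K rho0 rho1 e'0.
pose g : P := b *: (w^-1 *: 'X) ^+ n.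
have gw : g.[w] = b by rewrite hornerZ horner_exp hornerZ hornerX mulVf // expr1n mulr1.
pose F := @swap P \o shear (al *: 'X) \o @swap P \o shear g.
pose f := @swap C \o shear_pt (al *: 'X) \o @swap C \o shear_pt g.
have aF : tame_aut F f.
  by do !apply: tame_aut_comp; (exact: tame_aut_swap || exact: tame_aut_shear).
have Fa : F axis = ('X + al *: g, g).
  by rewrite /F /= /swap /shear /= add0r comp_polyXr comp_polyZ comp_polyX.
have small : cnorm2 r (F axis - axis) <= Num.min 1 (e / (L + 1)).
  apply: le_trans Hn; rewrite Fa /cnorm2 /= subr0 addrAC subrr add0r cnormZ.
  rewrite /K -mulrA mulrDl mul1r.
  have gn : cnorm r g <= cabs b * (r / (r + 1)) ^+ n.
    rewrite cnormZ ler_wpM2l ?cabs_ge0 //.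
    apply: le_trans (cnormXn _ _ r0) _.
    rewrite cnormZ cnormX cabsV cabs_real ger0_norm ?addr_ge0 //.
    by rewrite mulrC.
  by rewrite lerD // ler_wpM2l ?cabs_ge0.
exists (T \o F), (t \o f), w; split; first exact: tame_aut_comp.
  have h1 : cnorm2 r (F axis - axis) <= 1.
    by apply: le_trans small _; rewrite ge_min lexx.
  have h2 : cnorm2 r (F axis - axis) <= e / (L + 1).
    by apply: le_trans small _; rewrite ge_min lexx orbT.
  have bF : cnorm2 r (F axis) <= cnorm2 r axis + 1.
    by apply: le_trans (cnorm2B _ axis r0) _; rewrite lerD2l.
  have bA : cnorm2 r axis <= cnorm2 r axis + 1 by lra.
  apply: le_trans (HL _ _ bF bA) _.
  rewrite ler_pdivlMr // in h2; apply: le_trans h2.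
  by rewrite mulrC; have := cnorm2_ge0 (F axis - axis) r0; nra.
rewrite /= evT Fa /eval2 /= hornerD hornerX hornerZ gw -tq; congr (t (_, _)).
by rewrite divfK // addrC subrK.
Qed.

End Polynomial_automorphisms.
(** * Limits of polynomials that converge in coefficient norm *)

Section Limits.
Variable R : realType.
Local Notation C := (Cplx R).
Local Notation P := {poly Cplx R}.

(** Since the tolerances at least halve, the intervals from
[x n - 2 * e n] to [x n + 2 * e n] are nested; the limit is the supremum of their left
ends.  The start [n0] is there because at a point [z] the estimates hold only
for discs that contain [z]. *)
Lemma real_limit (x e : nat -> R) n0 :
  (forall n, (n0 <= n)%N -> `|x n.+1 - x n| <= e n) ->
  (forall n, e n.+1 <= e n / 2) ->
  exists l, forall n, (n0 <= n)%N -> `|l - x n| <= 2 * e n.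
Proof.
move=> xe e2.
have mono n k : (n0 <= n)%N ->
    x n - 2 * e n <= x (n + k)%N - 2 * e (n + k)%N /\
    x (n + k)%N + 2 * e (n + k)%N <= x n + 2 * e n.
  move=> n0n; elim: k => [|k [IH1 IH2]]; first by rewrite addn0.
  have := xe _ (leq_trans n0n (leq_addr k n)); have := e2 (n + k)%N.
  by rewrite addnS ler_norml => h1 /andP[h2 h3]; split; lra.
have egt0 n : (n0 <= n)%N -> 0 <= e n.
  by move=> n0n; apply: le_trans (normr_ge0 _) (xe n n0n).
have cross n m : (n0 <= n)%N -> (n0 <= m)%N -> x m - 2 * e m <= x n + 2 * e n.
  move=> n0n n0m; have [nm|/ltnW mn] := leqP n m.
    have := (mono n (m - n)%N n0n).2; rewrite subnKC //.
    by have := egt0 m n0m; lra.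
  have := (mono m (n - m)%N n0m).1; rewrite subnKC //.
  by have := egt0 n n0n; lra.
pose A := [set y | exists2 m, (n0 <= m)%N & y = x m - 2 * e m].
have A0 : A !=set0 by exists (x n0 - 2 * e n0), n0.
have ubA n : (n0 <= n)%N -> ubound A (x n + 2 * e n).
  by move=> n0n y [m n0m ->]; apply: cross.
exists (sup A) => n n0n.
have h1 : sup A <= x n + 2 * e n by apply: ge_sup => //; apply: ubA.
have h2 : x n - 2 * e n <= sup A.
  by apply: ub_le_sup; [exists (x n + 2 * e n); apply: ubA|exists n].
by rewrite ler_norml; apply/andP; split; lra.
Qed.

Lemma complex_limit (x : nat -> C) (e : nat -> R) n0 :
  (forall n, (n0 <= n)%N -> cabs (x n.+1 - x n) <= e n) ->
  (forall n, e n.+1 <= e n / 2) ->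
  exists l, forall n, (n0 <= n)%N -> cabs (l - x n) <= 4 * e n.
Proof.
move=> xe e2.
have ReB (z w : C) : complex.Re (z - w) = complex.Re z - complex.Re w.
  by case: z w => a b [c d].
have ImB (z w : C) : complex.Im (z - w) = complex.Im z - complex.Im w.
  by case: z w => a b [c d].
have [n n0n|a Ha] := @real_limit (fun n => complex.Re (x n)) e n0 _ e2.
  by rewrite -ReB; apply: le_trans (cabs_Re _) (xe n n0n).
have [n n0n|b Hb] := @real_limit (fun n => complex.Im (x n)) e n0 _ e2.
  by rewrite -ImB; apply: le_trans (cabs_Im _) (xe n n0n).
exists ((a +i* b)%C : C) => n n0n; apply: le_trans (cabs_ReIm _) _.
by rewrite ReB ImB /=; have := Ha n n0n; have := Hb n n0n; lra.
Qed.

(** Discs of radius [r n] exhaust the plane and the [n]-th correction is below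
[e n] on a disc wider by 1, the margin that the Lipschitz estimate needs. *)
Section Polynomial_limit.
Variables (r e : nat -> R) (p : nat -> P).
Hypotheses (r0 : forall n, 0 <= r n) (rS : forall n, r n + 1 <= r n.+1).
Hypotheses (e0 : forall n, 0 < e n) (eS : forall n, e n.+1 <= e n / 2).
Hypothesis pS : forall n, cnorm (r n + 1) (p n.+1 - p n) <= e n.

Lemma radius_mono n m : (n <= m)%N -> r n <= r m.
Proof.
move=> /subnK <-; elim: (m - n)%N => [|k IH]; first by rewrite add0n.
by rewrite addSn; have := rS (k + n); lra.
Qed.

Lemma radius_unbounded (x : R) : exists n, x <= r n.
Proof.
have nr n : n%:R <= r n.
  by elim: n => [|n IH]; [exact: r0|rewrite -natr1; have := rS n; lra].
exists (Num.truncn x).+1; apply: le_trans (nr _); apply: ltW.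
by rewrite truncnS_gt.
Qed.

Lemma le_of_tolerances (x y K : R) n :
  (forall m, (n <= m)%N -> x <= y + K * e m) -> x <= y.
Proof.
move=> H; apply/ler_addgt0Pr => d d0.
have half0 : 0 <= (2^-1 : R) by lra.
have half1 : (2^-1 : R) < 1 by lra.
have eb m : e m <= e 0 * 2^-1 ^+ m.
  elim: m => [|m IH]; first by rewrite expr0 mulr1.
  by apply: le_trans (eS m) _; rewrite exprSr mulrA ler_wpM2r.
have [m Hm] := exists_expr_le (`|K| * e 0) half0 half1 d0.
have Hnm : `|K| * e 0 * 2^-1 ^+ (m + n) <= d.
  apply: le_trans Hm; rewrite ler_wpM2l ?mulr_ge0 ?(ltW (e0 0)) //.
  by rewrite ler_wiXn2l ?leq_addr // ltW.
apply: le_trans (H (m + n)%N (leq_addl m n)) _; rewrite lerD2l.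
apply: le_trans Hnm; rewrite -mulrA.
apply: le_trans (ler_wpM2r (ltW (e0 _)) (ler_norm K)) _.
by rewrite ler_wpM2l.
Qed.

(** The term [- 2 e (n + k)] makes the induction go through: it leaves room for
the next correction. *)
Lemma cnorm_telescope n k :
  cnorm (r n + 1) (p (n + k)%N - p n) <= 2 * e n - 2 * e (n + k)%N.
Proof.
elim: k => [|k IH]; first by rewrite addn0 !subrr cnorm0.
rewrite addnS; have -> : p (n + k).+1 - p n =
  (p (n + k).+1 - p (n + k)%N) + (p (n + k)%N - p n) by ring.
have rn : 0 <= r n + 1 by have := r0 n; lra.
apply: le_trans (cnormD _ _ rn) _.
have : cnorm (r n + 1) (p (n + k).+1 - p (n + k)%N) <= e (n + k)%N.
  by apply: le_trans (pS _); rewrite cnorm_le // lerD2r radius_mono ?leq_addr.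
by have := eS (n + k); lra.
Qed.

Lemma cnorm_tail n m : (n <= m)%N -> cnorm (r n + 1) (p m - p n) <= 2 * e n.
Proof.
by move=> /subnKC <-; have := cnorm_telescope n (m - n); have := e0 (n + (m - n)); lra.
Qed.

(** The limit [F] with its derivative [G], which is the limit of the derivatives.
Each claim holds for the polynomials [p m], uniformly in [m], up to an error of
the order of [e m]; let [m] grow. *)
Lemma polynomial_limit : exists F G : C -> C,
  [/\ forall n z, cabs z <= r n -> cabs (F z - (p n).[z]) <= 4 * e n,
      forall n z w, cabs z <= r n -> cabs w <= r n ->
        cabs ((F z - (p n).[z]) - (F w - (p n).[w])) <= 2 * e n * cabs (z - w)
    & forall z, exists K, forall h, cabs h <= 1 ->
        cabs (F (z + h) - F z - h * G z) <= K * cabs h ^+ 2].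
Proof.
have rn1 n : r n <= r n + 1 by lra.
have /choice[F HF] : forall z : C, exists l, forall n, cabs z <= r n ->
    cabs (l - (p n).[z]) <= 4 * e n.
  move=> z; have [n0 zn0 minn0] := ex_minnP (radius_unbounded (cabs z)).
  have [n n0n|l Hl] := @complex_limit (fun n => (p n).[z]) e n0 _ eS.
    rewrite -hornerN -hornerD; apply: le_trans (pS n); apply: cabs_horner.
    by apply: le_trans (rn1 _); apply: le_trans zn0 (radius_mono n0n).
  by exists l => n zn; apply: Hl; apply: minn0.
have /choice[G HG] : forall z : C, exists l, exists n0, forall n, (n0 <= n)%N ->
    cabs (l - (p n)^`().[z]) <= 4 * e n.
  move=> z; have [N zN] := radius_unbounded (cabs z).
  have [n Nn|l Hl] := @complex_limit (fun n => (p n)^`().[z]) e N _ eS.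
    rewrite -hornerN -hornerD -derivB; apply: le_trans (pS n).
    by apply: cabs_deriv; apply: le_trans zN (radius_mono Nn).
  by exists l, N.
exists F, G; split=> [n z|n z w zn wn|z]; first exact: HF.
  apply: (@le_of_tolerances _ _ 8 n) => m nm.
  have rnm := radius_mono nm.
  have h1 := HF z m (le_trans zn rnm); have h2 := HF w m (le_trans wn rnm).
  have h3 := cabs_horner_lip (p m - p n) zn wn.
  have h4 : cnorm (r n + 1) (p m - p n) * cabs (z - w) <= 2 * e n * cabs (z - w).
    by rewrite ler_wpM2r ?cabs_ge0 ?cnorm_tail.
  rewrite !(hornerD, hornerN) in h3.
  have -> : F z - (p n).[z] - (F w - (p n).[w]) =
    ((p m).[z] - (p n).[z] - ((p m).[w] - (p n).[w])) +
    ((F z - (p m).[z]) - (F w - (p m).[w])) by ring.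
  apply: le_trans (cabsD _ _) _.
  have := cabsD (F z - (p m).[z]) (- (F w - (p m).[w])); rewrite cabsN.
  lra.
have [n zn] := radius_unbounded (cabs z + 1).
have [n0 Hn0] := HG z.
exists (cnorm (r n + 1) (p n) + 2 * e n) => h h1.
apply: (@le_of_tolerances _ _ 12 (maxn n n0)) => m.
rewrite geq_max => /andP[nm n0m].
have rnm := radius_mono nm.
have zhm : cabs (z + h) <= r m by have := cabsD z h; lra.
have zm : cabs z <= r m by lra.
have := HF _ _ zhm; have := HF _ _ zm; have := Hn0 m n0m.
set d1 := F (z + h) - _; set d2 := F z - _; set d3 := G z - _ => b3 b2 b1.
have -> : F (z + h) - F z - h * G z =
  ((p m).[z + h] - (p m).[z] - h * (p m)^`().[z]) + (d1 - d2 - h * d3).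
  by rewrite /d1 /d2 /d3; ring.
apply: le_trans (cabsD _ _) _; rewrite lerD //.
  have zn1 : cabs z <= r n - 1 by lra.
  apply: le_trans (cabs_taylor (p m) zn1 h1) _.
  rewrite ler_wpM2r ?exprn_ge0 ?cabs_ge0 //.
  have -> : r n - 1 + 2 = r n + 1 by ring.
  have rn : 0 <= r n + 1 by have := r0 n; lra.
  have := cnormD (p n) (p m - p n) rn; have := cnorm_tail nm.
  by rewrite [p n + _]addrC subrK; lra.
have := cabsD (d1 - d2) (- (h * d3)); have := cabsD d1 (- d2).
have : cabs h * cabs d3 <= 1 * (4 * e m) by apply: ler_pM; rewrite ?cabs_ge0.
rewrite !cabsN cabsM; lra.
Qed.

End Polynomial_limit.
End Limits.
(** * The inductive construction of the line *)

Section Construction.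
Variable R : realType.
Local Notation C := (Cplx R).
Local Notation P := {poly Cplx R}.

(** Curves that an automorphism of the plane maps to a coordinate axis. *)
Definition straightenable (u : P * P) : Prop :=
  exists T t, tame_aut T t /\ u = T (axis R).

(** What the construction remembers: a curve, the disc over which it is already
nearly final, and a bound for the next correction over (a disc slightly wider
than) that disc.  As tolerances halve, all later corrections together stay
below twice the tolerance in coefficient norm. *)
Record stage := Stage { curve : P * P; radius : R; tolerance : R }.

Definition admissible (x : stage) : Prop :=
  [/\ straightenable (curve x), 0 <= radius x & 0 < tolerance x].

Definition close_to (x y : stage) : Prop :=
  [/\ radius x + 1 <= radius y, tolerance y <= tolerance x / 2
    & cnorm2 (radius x + 1) (curve y - curve x) <= tolerance x].

(** The properties of the curve of [y] in terms of its tolerance, with the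
margins that let them survive in the limit map: the limit is within 8 tolerances
of the curve over the disc, and differs from it by a map with Lipschitz constant
4 tolerances ([stage_limit]). *)
Definition reaches (q : C * C) (d M : R) (y : stage) : Prop :=
  [/\ exists2 z, cabs z <= radius y & eval2 (curve y) z = q,
      8 * tolerance y <= d,
      forall z, cabs z = radius y ->
        M + 8 * tolerance y <= cabs2 (eval2 (curve y) z)
    & forall z w, cabs z <= radius y -> cabs w <= radius y ->
        5 * tolerance y * cabs (z - w)
          <= cabs2 (eval2 (curve y) z - eval2 (curve y) w)].

Lemma next_stage q (d M : R) x : 0 < d -> admissible x ->
  exists y, [/\ admissible y, close_to x y & reaches q d M y].
Proof.
case: x => u r e d0 [/= [T [t [aT uE]]] r0 e0].
have r1 : 0 <= r + 1 by lra.
have [S [s [z [aS close hit]]]] := curve_through_point q aT r1 e0.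
have [rho Hrho] := curve_proper (M + 8) aS.
(* Beyond the radius [rho] the new curve has norm above [M + 8]; the disc also
   has to contain the parameter [z] of the point that was reached. *)
pose r' := Num.max (r + 1) (Num.max (cabs z) (rho + 1)).
have r'1 : r + 1 <= r' by rewrite le_max lexx.
have r'2 : cabs z <= r' by rewrite !le_max lexx orbT.
have r'3 : rho + 1 <= r' by rewrite !le_max lexx !orbT.
have r'0 : 0 <= r' by lra.
have [c c0 Hc] := curve_embedding aS r'0.
pose e' := Num.min (e / 2) (Num.min (d / 8) (Num.min 1 (c / 5))).
have e'0 : 0 < e' by rewrite !lt_min ltr01 !divr_gt0.
have e'1 : e' <= e / 2 by rewrite ge_min lexx.
have e'2 : e' <= d / 8 by rewrite !ge_min lexx !orbT.
have e'3 : e' <= 1 by rewrite !ge_min lexx !orbT.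
have e'4 : e' <= c / 5 by rewrite !ge_min lexx !orbT.
exists (Stage (S (axis R)) r' e'); split; split=> //=.
- by exists S, s.
- by rewrite uE.
- by exists z.
- by lra.
- move=> w wr; rewrite leNgt; apply/negP => h.
  by have := Hrho w; rewrite wr; lra.
- move=> z1 z2 h1 h2; apply: le_trans (Hc _ _ h1 h2).
  by rewrite ler_wpM2r ?cabs_ge0 //; lra.
Qed.

Lemma stage_sequence (q : nat -> C * C) (d M : nat -> R) : (forall n, 0 < d n) ->
  exists x : nat -> stage, forall n,
    [/\ admissible (x n), close_to (x n) (x n.+1)
      & reaches (q n) (d n) (M n) (x n.+1)].
Proof.
move=> d0.
have /choice[next Hnext] : forall nx : nat * stage, exists y, admissible nx.2 ->
    [/\ admissible y, close_to nx.2 y & reaches (q nx.1) (d nx.1) (M nx.1) y].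
  move=> [n x]; have [ax|nax] := pselect (admissible x); last by exists x.
  by have [y Hy] := next_stage (q n) (M n) (d0 n) ax; exists y.
pose x := fix x n := if n is k.+1 then next (k, x k) else Stage (axis R) 0 1.
have ax n : admissible (x n).
  elim: n => [|n IH]; last by have [] := Hnext (n, x n) IH.
  split=> //=.
  by exists id, id; split=> //; exact: tame_aut_id.
by exists x => n; have [_ h1 h2] := Hnext (n, x n) (ax n); split.
Qed.

(** The two coordinates converge separately; the constants double when they are
added up. *)
Lemma stage_limit (x : nat -> stage) :
  (forall n, admissible (x n) /\ close_to (x n) (x n.+1)) ->
  exists F G : C -> C * C,
  [/\ forall n z, cabs z <= radius (x n) ->
        cabs2 (F z - eval2 (curve (x n)) z) <= 8 * tolerance (x n),
      forall n z w, cabs z <= radius (x n) -> cabs w <= radius (x n) ->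
        cabs2 ((F z - eval2 (curve (x n)) z) - (F w - eval2 (curve (x n)) w))
          <= 4 * tolerance (x n) * cabs (z - w),
      forall z, exists K, forall h, cabs h <= 1 ->
        cabs2 (F (z + h) - F z - (h * (G z).1, h * (G z).2)) <= K * cabs h ^+ 2
    & forall a, exists n, a <= radius (x n)].
Proof.
move=> Hx.
pose r n := radius (x n); pose e n := tolerance (x n).
have r0 n : 0 <= r n by have [[]] := Hx n.
have rS n : r n + 1 <= r n.+1 by have [_ []] := Hx n.
have e0 n : 0 < e n by have [[]] := Hx n.
have eS n : e n.+1 <= e n / 2 by have [_ []] := Hx n.
have r1 n : 0 <= r n + 1 by have := r0 n; lra.
have cS n : cnorm2 (r n + 1) (curve (x n.+1) - curve (x n)) <= e n.
  by have [_ []] := Hx n.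
have [n|F1 [G1 [A1 B1 D1]]] :=
    @polynomial_limit R r e (fun n => (curve (x n)).1) r0 rS e0 eS.
  by apply: le_trans (cS n); rewrite lerDl cnorm_ge0.
have [n|F2 [G2 [A2 B2 D2]]] :=
    @polynomial_limit R r e (fun n => (curve (x n)).2) r0 rS e0 eS.
  by apply: le_trans (cS n); rewrite lerDr cnorm_ge0.
exists (fun z => (F1 z, F2 z)), (fun z => (G1 z, G2 z)); split.
- move=> n z zn; have := A1 n z zn; have := A2 n z zn.
  by rewrite /cabs2 /e /=; lra.
- move=> n z w zn wn; have := B1 n z w zn wn; have := B2 n z w zn wn.
  by rewrite /cabs2 /e /=; lra.
- move=> z; have [K1 H1] := D1 z; have [K2 H2] := D2 z.
  exists (K1 + K2) => h h1; have := H1 h h1; have := H2 h h1.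
  by rewrite /cabs2 /=; lra.
- exact: radius_unbounded.
Qed.

(** The limit map and the estimates on it from which the theorem follows by
soft arguments.  The points [q n] are approached rather than attained, within the
prescribed errors [d n]. *)
Lemma dense_line_data (q : nat -> C * C) (d : nat -> R) : (forall n, 0 < d n) ->
  exists F G : C -> C * C,
  [/\ forall z, exists K, forall h, cabs h <= 1 ->
        cabs2 (F (z + h) - F z - (h * (G z).1, h * (G z).2)) <= K * cabs h ^+ 2,
      forall r, exists2 c, 0 < c & forall z w, cabs z <= r -> cabs w <= r ->
        c * cabs (z - w) <= cabs2 (F z - F w),
      forall M, exists2 r, M <= r & forall z, cabs z = r -> M <= cabs2 (F z)
    & forall n, exists z, cabs2 (F z - q n) <= d n].
Proof.
move=> d0; have [x Hx] := stage_sequence q (fun n => n%:R) d0.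
have [n|F [G [near lip diff unbounded]]] := @stage_limit x.
  by have [] := Hx n.
have e0 n : 0 < tolerance (x n) by have [[]] := Hx n.
exists F, G; split=> // [r|M|n].
- have [n rn] := unbounded r; have [[_ _ en] [rS _ _] [_ _ _ emb]] := Hx n.
  exists (tolerance (x n.+1)) => // z w zr wr.
  have zS : cabs z <= radius (x n.+1) by lra.
  have wS : cabs w <= radius (x n.+1) by lra.
  have := emb z w zS wS; have := lip n.+1 z w zS wS.
  set a := eval2 _ z; set b := eval2 _ w.
  have := cabs2B (a - b) (F z - F w).
  rewrite [cabs2 (a - b - _)]cabs2BC.
  rewrite (_ : F z - F w - (a - b) = F z - a - (F w - b)); first by lra.
  by rewrite !opprB addrACA [RHS]addrACA [- F w - a]addrC.
- have [n rn] := unbounded M; pose m := (n + (Num.truncn M).+1)%N.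
  have [[_ _ em] [rS _ _] [_ _ circle _]] := Hx m.
  have rmono : radius (x n) <= radius (x m).
    apply: (@radius_mono R (fun n => radius (x n))) => [k|]; last exact: leq_addr.
    by have [_ []] := Hx k.
  exists (radius (x m.+1)) => [|z zr]; first by lra.
  have := circle z zr; have := near m.+1 z; rewrite zr lexx => /(_ isT).
  rewrite cabs2BC; have := cabs2B (eval2 (curve (x m.+1)) z) (F z).
  have : M <= m%:R.
    by apply/ltW/(lt_le_trans (truncnS_gt M)); rewrite ler_nat leq_addl.
  by lra.
- have [_ _ [[z zr zq] dn _ _]] := Hx n; exists z.
  by rewrite -zq; apply: le_trans dn; apply: near.
Qed.

End Construction.
(** * Derivative, completeness and density of the limit map *)

Section Analysis.
Variable R : realType.
Local Notation C := (Cplx R).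
Implicit Types (a b : C * C) (z w : C) (F G : C -> C * C).

Lemma pos_complex (e : C) : 0 < e -> exists2 d : R, 0 < d & e = d%:C%C.
Proof.
move=> e0; exists (complex.Re e).
  by move: e0; case: e => x y; rewrite ltcE => /andP[].
by case: e e0 => x y; rewrite ltcE /= => /andP[/eqP ->].
Qed.

Lemma norm_leE z (d : R) : (`|z| <= d%:C%C) = (cabs z <= d).
Proof. by rewrite cabsE lecR. Qed.

Definition row_pair a : 'rV[C]_2 := \row_j (if j == 0 then a.1 else a.2).

Lemma row_pairB a b : row_pair (a - b) = row_pair a - row_pair b.
Proof. by apply/rowP => j; rewrite !mxE; case: ifP. Qed.

Lemma row_pairZ z a : row_pair (z * a.1, z * a.2) = z *: row_pair a.
Proof. by apply/rowP => j; rewrite !mxE; case: ifP. Qed.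

Lemma row_pairK : cancel row_pair (fun v => (v 0 0, v 0 1)).
Proof. by move=> [x y]; rewrite !mxE /=. Qed.

Lemma norm_row_pair a : `|row_pair a| <= (cabs2 a)%:C%C.
Proof.
rewrite [leLHS](_ : _ = mx_norm (row_pair a)) //.
have [->|/mx_norm_neq0[[i j] /= ->]] := eqVneq (mx_norm (row_pair a)) 0.
  by rewrite lecR cabs2_ge0.
rewrite mxE norm_leE /cabs2.
by case: ifP => _; rewrite ?lerDl ?lerDr cabs_ge0.
Qed.

Lemma euclid_norm_row_pair a : cabs2 a <= 2 * euclid_norm (row_pair a).
Proof.
rewrite /euclid_norm big_ord_recl big_ord1 !mxE /=.
have le (x : C) (s : R) :
    complex.Re x ^+ 2 + complex.Im x ^+ 2 <= s -> cabs x <= Num.sqrt s.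
  by move=> xs; rewrite cabs_def ler_wsqrtr.
set s := (X in Num.sqrt X).
have h1 : cabs a.1 <= Num.sqrt s.
  by apply: le; rewrite /s lerDl addr_ge0 ?sqr_ge0.
have h2 : cabs a.2 <= Num.sqrt s.
  by apply: le; rewrite /s lerDr addr_ge0 ?sqr_ge0.
by rewrite /cabs2; lra.
Qed.

Lemma cabs2Z z a : cabs2 (z * a.1, z * a.2) = cabs z * cabs2 a.
Proof. by rewrite /cabs2 /= !cabsM mulrDr. Qed.

Definition has_derivative F G : Prop := forall z, exists K, forall h,
  cabs h <= 1 ->
  cabs2 (F (z + h) - F z - (h * (G z).1, h * (G z).2)) <= K * cabs h ^+ 2.

(** The second order remainder, divided by [h], is bounded by [K |h|]. *)
Lemma diff_quotient F G z : has_derivative F G ->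
  h^-1 *: (row_pair (F (h *: 1 + z)) - row_pair (F z)) @[h --> 0^']
    --> row_pair (G z).
Proof.
move=> /(_ z)[K HK]; apply/cvgrPdist_le => e /pos_complex[d d0 ->].
have K1 : 0 < `|K| + 1 by rewrite ltr_wpDl.
have m0 : 0 < Num.min 1 (d / (`|K| + 1)) by rewrite lt_min ltr01 divr_gt0.
near=> h.
have h0 : h != 0 by near: h; exact: nbhs_dnbhs_neq.
have : `|h| <= (Num.min 1 (d / (`|K| + 1)))%:C%C.
  by near: h; apply: dnbhs0_le; rewrite ltcR.
rewrite norm_leE le_min => /andP[h1 hd].
rewrite /= [h *: 1]mulr1 (addrC h) -row_pairB distrC.
have -> : h^-1 *: row_pair (F (z + h) - F z) - row_pair (G z)
  = h^-1 *: row_pair (F (z + h) - F z - (h * (G z).1, h * (G z).2)).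
  by rewrite [in RHS]row_pairB scalerBr row_pairZ scalerK.
rewrite -row_pairZ; apply: le_trans (norm_row_pair _) _.
rewrite lecR cabs2Z cabsV; have habs : 0 < cabs h by rewrite cabs_gt0.
rewrite mulrC ler_pdivrMr //; apply: le_trans (HK h h1) _.
rewrite expr2 mulrA ler_wpM2r ?cabs_ge0 //.
rewrite ler_pdivlMr // in hd; have := ler_norm K.
by have := cabs_ge0 h; nra.
Unshelve. all: by end_near.
Qed.

Lemma row_pair_differentiable F G z : has_derivative F G ->
  differentiable (row_pair \o F) z /\
  forall h, 'd (row_pair \o F) z h = h *: row_pair (G z).
Proof.
move=> FG; have cv := diff_quotient (z := z) FG.
have df : differentiable (row_pair \o F) z.
  by apply/derivable1_diffP; apply: cvgP cv.
split=> // h; rewrite diff1E // derive1E; congr (_ *: _).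
by apply: cvg_lim cv; exact: norm_hausdorff.
Qed.

(** If [G z = 0] then the increment of [F] at [z] is at most [K |h|^2], which for
small [h] contradicts the lower bound [c |h|]. *)
Lemma derivative_neq0 F G z (c : R) : has_derivative F G -> 0 < c ->
  (forall w, cabs w <= cabs z + 1 -> c * cabs (w - z) <= cabs2 (F w - F z)) ->
  G z != 0.
Proof.
move=> /(_ z)[K HK] c0 Hc; apply/negP => /eqP Gz.
have K1 : 0 < `|K| + 1 by rewrite ltr_wpDl.
pose d := Num.min 1 (c / (2 * (`|K| + 1))).
have d0 : 0 < d by rewrite lt_min ltr01 divr_gt0 // mulr_gt0.
have d1 : d <= 1 by rewrite ge_min lexx.
have d2 : d <= c / (2 * (`|K| + 1)) by rewrite ge_min lexx orbT.
have dE : cabs (d%:C%C : C) = d by rewrite cabs_real gtr0_norm.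
have := HK d%:C%C; rewrite dE Gz /= !mulr0 => /(_ d1).
have -> : ((0, 0) : C * C) = 0 by [].
rewrite subr0 => h1.
have := Hc (z + d%:C%C); rewrite [z + _ - z]addrAC subrr add0r dE.
have zd : cabs (z + (d%:C%C : C)) <= cabs z + 1.
  by apply: le_trans (cabsD _ _) _; rewrite dE lerD2l.
move=> /(_ zd) h2.
rewrite ler_pdivlMr ?mulr_gt0 // in d2.
have := ler_norm K => h3.
have h4 : c * d <= K * d * d by rewrite -mulrA -expr2; apply: le_trans h2 h1.
have h5 : c <= K * d by rewrite -(ler_pM2r d0).
nra.
Qed.

Lemma near_cabs z (d : R) : 0 < d -> \forall w \near z, cabs (z - w) <= d.
Proof.
move=> d0; apply/nbhs_normP; exists d%:C%C => [|w /ltW]; first by rewrite /= ltcR.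
by rewrite norm_leE.
Qed.

Lemma cabs_continuous : continuous (@cabs R).
Proof.
move=> z; apply/(@cvgrPdist_le _ _ _ (nbhs z) (nbhs_filter z)) => e e0.
near=> w; have : cabs (z - w) <= e by near: w; exact: near_cabs.
apply: le_trans; rewrite ler_norml; apply/andP; split.
  by have := cabsB w z; rewrite cabsBC; lra.
by have := cabsB z w; lra.
Unshelve. all: by end_near.
Qed.

Lemma near_coordinates (x : R * R) (d : R) : 0 < d ->
  \forall y \near x, `|x.1 - y.1| <= d /\ `|x.2 - y.2| <= d.
Proof.
move=> d0; apply/nbhs_normP; exists d => //= y /= /ltW.
by rewrite prod_normE /= ge_max => /andP[].
Qed.

(** Squares rather than discs, since they are images of products of segments. *)
Lemma square_compact (r : R) :
  compact [set z : C | `|complex.Re z| <= r /\ `|complex.Im z| <= r].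
Proof.
pose m (x : R * R) : C := (x.1 +i* x.2)%C.
have mc : continuous m.
  move=> x; apply/(@cvgrPdist_le _ _ _ (nbhs x) (nbhs_filter x)).
  move=> e /pos_complex[d d0 ->].
  have d2 : 0 < d / 2 by lra.
  near=> y; have [h1 h2] : `|x.1 - y.1| <= d / 2 /\ `|x.2 - y.2| <= d / 2.
    by near: y; exact: near_coordinates.
  rewrite norm_leE; apply: le_trans (cabs_ReIm _) _; rewrite /m /=; lra.
have := continuous_compact (continuous_subspaceT mc)
  (compact_setX (@segment_compact R (- r) r) (@segment_compact R (- r) r)).
congr (compact _); apply/seteqP; split=> [z [[a b] [/= ha hb] <-]|z [h1 h2]] /=.
  by rewrite !in_itv /= in ha hb; rewrite !ler_norml.
exists (complex.Re z, complex.Im z); last by case: z {h1 h2}.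
by rewrite /= !in_itv /= -!ler_norml.
Unshelve. all: by end_near.
Qed.

(** A divergent path leaves the compact square that contains the disc, so its
modulus takes the value [r] by the intermediate value theorem. *)
Lemma divergent_path_meets_circle (g : R -> C) (r : R) :
  divergent_path g -> cabs (g 0) < r ->
  exists t, [/\ 0 < t, t < 1 & cabs (g t) = r].
Proof.
move=> [gc gd] gr; have [t0 t01 Ht0] := gd _ (square_compact (r := r)).
move: t01; rewrite in_itv /= => /andP[t00 t01].
have gt0 : r < cabs (g t0).
  rewrite ltNge; apply/negP => gt0; apply: (Ht0 t0); first by rewrite lexx.
  by split; apply: le_trans gt0; [exact: cabs_Re|exact: cabs_Im].
have cont : {within `[0, t0], continuous (@cabs R \o g)}.
  apply: within_continuous_comp => [z _|]; first exact: cabs_continuous.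
  apply: continuous_subspaceW gc => t /=; rewrite !in_itv /= => /andP[-> h].
  exact: le_lt_trans h t01.
have [|t] := IVT (v := r) t00 cont.
  by rewrite /= ge_min (ltW gr) le_max (ltW gt0) orbT.
rewrite in_itv /= => /andP[t_ge0 t_le] tr; exists t; split=> //.
  rewrite lt_def t_ge0 andbT; apply/negP => /eqP t0E.
  by move: gr; rewrite -tr t0E ltxx.
exact: le_lt_trans t_le t01.
Qed.

Lemma euclid_length_chord n (c : R -> 'rV[C]_n) t : 0 < t -> t < 1 ->
  ((euclid_norm (c t - c 0))%:E <= euclid_length c)%E.
Proof.
move=> t0 t1; apply: (@le_trans _ _ (arc_length 0 t c)).
  apply: ereal_sup_ubound; exists [:: t]; first exact: itv_partition1.
  by rewrite /polygonal_length /= big_nat1.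
by apply: ereal_sup_ubound; exists t => //=; rewrite in_itv /= ltW.
Qed.

(** The length of a path is at least the distance from its origin to any of its
points, and the points on the circles of the hypothesis are arbitrarily far. *)
Lemma complete_of_circles F :
  (forall M, exists2 r, M <= r & forall z, cabs z = r -> M <= cabs2 (F z)) ->
  complete_map (row_pair \o F).
Proof.
move=> circ g dg; apply: eq_infty => A.
have [r Mr Hr] := circ (2 * `|A| + cabs2 (F (g 0)) + cabs (g 0) + 1).
have gr : cabs (g 0) < r.
  by have := normr_ge0 A; have := cabs2_ge0 (F (g 0)); lra.
have [t [t0 t1 tr]] := divergent_path_meets_circle dg gr.
apply: le_trans (euclid_length_chord _ t0 t1); rewrite lee_fin /= -row_pairB.
have := euclid_norm_row_pair (F (g t) - F (g 0)).
have := cabs2B (F (g t)) (F (g 0)); have := Hr _ tr.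
have := ler_norm A; have := cabs_ge0 (g 0); lra.
Qed.

Definition rational_point (k : (rat * rat) * (rat * rat)) : C * C :=
  ((ratr k.1.1 +i* ratr k.1.2)%C, (ratr k.2.1 +i* ratr k.2.2)%C).

Lemma rational_point_dense a (d : R) : 0 < d ->
  exists k, cabs2 (rational_point k - a) <= d.
Proof.
move=> d0.
have approx (x : R) : exists k : rat, `|ratr k - x| <= d / 4.
  have [|k] := @rat_in_itvoo R (x - d / 4) (x + d / 4); first by lra.
  rewrite in_itv /= => /andP[h1 h2]; exists k.
  by rewrite ler_norml; apply/andP; split; lra.
case: a => [[x1 y1] [x2 y2]].
have [k1 h1] := approx x1; have [k2 h2] := approx y1.
have [k3 h3] := approx x2; have [k4 h4] := approx y2.
exists ((k1, k2), (k3, k4)); rewrite /cabs2 /=.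
have := cabs_ReIm ((ratr k1 +i* ratr k2)%C - (x1 +i* y1)%C : C).
have := cabs_ReIm ((ratr k3 +i* ratr k4)%C - (x2 +i* y2)%C : C).
by rewrite /=; lra.
Qed.

(** The integers encode all pairs of a rational point and a required precision
[1 / (m + 1)], so that each rational point is aimed at with every precision. *)
Definition request (n : nat) : option (((rat * rat) * (rat * rat)) * nat) :=
  unpickle n.

Definition target (n : nat) : C * C :=
  if request n is Some (k, _) then rational_point k else 0.

Definition precision (n : nat) : R :=
  if request n is Some (_, m) then m.+1%:R^-1 else 1.

Lemma precision_gt0 n : 0 < precision n.
Proof. by rewrite /precision; case: request => [[_ m]|]. Qed.

Lemma dense_of_targets F :
  (forall n, exists z, cabs2 (F z - target n) <= precision n) ->
  dense (range (row_pair \o F)).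
Proof.
move=> HF O [v Ov] oO; have : nbhs v O by exact: open_nbhs_nbhs.
move=> /nbhs_normP[e /= /pos_complex[d d0 ->]] vO.
pose a : C * C := (v 0 0, v 0 1).
have av : row_pair a = v.
  apply/rowP => j; rewrite !mxE; case: j => [[|[|//]] i] /=;
    by congr (v _ _); apply: val_inj.
have d3 : 0 < d / 3 by lra.
have [k Hk] := rational_point_dense a d3.
have [m Hm] : exists m, m.+1%:R^-1 <= d / 3.
  exists (Num.truncn (d / 3)^-1); rewrite -[leRHS]invrK lef_pV2 ?posrE ?invr_gt0 //.
  by apply: ltW; rewrite truncnS_gt.
have [z Hz] := HF (pickle (k, m)).
rewrite /target /precision /request pickleK in Hz.
exists (row_pair (F z)); split; last by exists z.
apply: vO; rewrite /ball_ /= -av -row_pairB.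
apply: le_lt_trans (norm_row_pair _) _; rewrite ltcR cabs2BC.
have -> : F z - a = (F z - rational_point k) + (rational_point k - a).
  by rewrite addrA subrK.
by apply: le_lt_trans (cabs2D _ _) _; have := le_trans Hz Hm; lra.
Qed.

End Analysis.

Theorem corollary1p2 (R : realType) :
  exists f : Cplx R -> 'rV[Cplx R]_2,
    [/\ holomorphic f, immersion f, injective f, complete_map f
      & dense (range f)].
Proof.
have [F [G [FG emb circ hit]]] := dense_line_data (@target R) (@precision_gt0 R).
have dif z := row_pair_differentiable z FG.
exists (@row_pair R \o F); split.
- by move=> z; have [] := dif z.
- move=> z h1 h2; have [_ dE] := dif z; rewrite !dE => /eqP.
  rewrite -subr_eq0 -scalerBl scaler_eq0 subr_eq0 => /orP[/eqP //|/eqP Gz].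
  have [c c0 Hc] := emb (cabs z + 1).
  have z1 : cabs z <= cabs z + 1 by lra.
  have /eqP[] := derivative_neq0 FG c0 (fun w wz => Hc w z wz z1).
  apply: (can_inj (@row_pairK R)); rewrite Gz.
  by apply/rowP => j; rewrite !mxE; case: ifP.
- move=> z w /(can_inj (@row_pairK R)) Fzw.
  have [c c0 Hc] := emb (Num.max (cabs z) (cabs w)).
  have := Hc z w; rewrite !le_max !lexx orbT => /(_ isT isT).
  rewrite Fzw subrr /cabs2 /= cabs0 addr0 pmulr_rle0 // => zw.
  by apply/eqP; rewrite -subr_eq0 -cabs_eq0 eq_le zw cabs_ge0.
- exact: complete_of_circles.
- exact: dense_of_targets.
Qed.
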